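(* The inv-Wilf equivalence classes of single permutations satisfy $$[123]_{\mathrm{inv}}=\{123\},\qquad [321]_{\mathrm{inv}}=\{321\},\qquad [132]_{\mathrm{inv}}=\{132,213\},\qquad [231]_{\mathrm{inv}}=\{231,312\},$$ and these are all the inv-Wilf equivalence classes involving single elements of $\mathfrak S_3$.
   Context: $\mathfrak S_n$ is the set of permutations $\sigma=a_1a_2\ldots a_n$ of $[n]=\{1,\dots,n\}$ in one-line notation, and $\mathfrak S=\bigcup_{n\ge0}\mathfrak S_n$. A permutation $\sigma$ contains $\pi\in\mathfrak S_k$ as a pattern if some subsequence of $\sigma$ of length $k$ is order isomorphic to $\pi$ (has its entries in the same relative order); otherwise $\sigma$ avoids $\pi$. $\mathrm{Av}_n(\pi)$ is the set of $\sigma\in\mathfrak S_n$ avoiding $\pi$. The inversion number is $\mathrm{inv}\,\sigma=\#\{(i,j): i<j,\ a_i>a_j\}$, and $I_n(\pi;q)=\sum_{\sigma\in \mathrm{Av}_n(\pi)}q^{\mathrm{inv}\,\sigma}$. Permutations $\pi,\pi'$ are inv-Wilf equivalent if $I_n(\pi;q)=I_n(\pi';q)$ for all $n\ge0$; $[\pi]_{\mathrm{inv}}$ denotes the set of single permutations $\pi'\in\mathfrak S$ that are inv-Wilf equivalent to $\pi$. *)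

(* Defs.v *)
From HB Require Import structures.
From mathcomp Require Import all_boot all_order all_fingroup all_algebra.
From mathcomp Require Import classical_sets.

Set Implicit Arguments.
Unset Strict Implicit.
Unset Printing Implicit Defensive.

Import GRing.Theory.
Local Open Scope ring_scope.

(* The disjoint union of the 'S_n, n >= 0. The entry a_(i+1) of the one-line
   notation of s : 'S_n is (s i).+1, since 'I_n is {0, ..., n - 1}. *)
Definition permutation : Type := {n : nat & 'S_n}.

Definition one_line n (s : 'S_n) : seq nat := [seq (val (s i)).+1 | i : 'I_n].

(* The defaults given to insubd (the identity permutation, the index i) are
   only reached when w is not a rearrangement of 1, ..., size w; otherwise
   see of_wordK. *)
Definition of_word (w : seq nat) : 'S_(size w) :=
  insubd (1%g : 'S_(size w))
    [ffun i : 'I_(size w) => insubd i (nth 0%N w i).-1].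

Lemma of_wordK (w : seq nat) :
  perm_eq w (iota 1 (size w)) -> one_line (of_word w) = w.
Proof.
move=> w_perm.
have w_bnd (i : 'I_(size w)) : (0 < nth 0 w i <= size w)%N.
  have := mem_nth 0%N (ltn_ord i).
  by rewrite (perm_mem w_perm) mem_iota add1n ltnS.
have w_uniq : uniq w by rewrite (perm_uniq w_perm) iota_uniq.
pose f := [ffun i : 'I_(size w) => insubd i (nth 0%N w i).-1].
have fE i : (val (f i)).+1 = nth 0%N w i.
  have /andP[w_gt0 w_le] := w_bnd i.
  by rewrite ffunE val_insubd prednK // w_le prednK.
have f_inj : injectiveb f.
  apply/injectiveP => i j fij; apply: val_inj; apply/eqP.
  by rewrite -(nth_uniq 0%N (ltn_ord i) (ltn_ord j) w_uniq) -!fE fij.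
have of_wordE i : (val (of_word w i)).+1 = nth 0%N w i.
  have valE : pval (of_word w) = f by rewrite [LHS]val_insubd f_inj.
  by rewrite -fE -pvalE valE.
apply: (@eq_from_nth _ 0%N) => [|i].
  by rewrite size_map -cardE card_ord.
rewrite size_map -cardE card_ord => lt_i.
rewrite (nth_map (Ordinal lt_i)) ?size_enum_ord // of_wordE.
by rewrite nth_enum_ord.
Qed.

Definition word (w : seq nat) : permutation :=
  Tagged (fun n => 'S_n) (of_word w).

Definition contains k n (s : 'S_n) (p : 'S_k) : bool :=
  [exists f : {ffun 'I_k -> 'I_n},
     [forall i : 'I_k, forall j : 'I_k, (i < j)%N ==> (f i < f j)%N] &&
     [forall i : 'I_k, forall j : 'I_k, (s (f i) < s (f j))%N == (p i < p j)%N]].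

Definition Av n k (p : 'S_k) : {set 'S_n} := [set s | ~~ contains s p]%SET.

Definition inv n (s : 'S_n) : nat :=
  #|[set ij : 'I_n * 'I_n | (ij.1 < ij.2)%N && (s ij.2 < s ij.1)%N]%SET|.

Definition inv_poly n k (p : 'S_k) : {poly int} :=
  \sum_(s in Av n p) 'X^(inv s).

Definition inv_Wilf (p p' : permutation) : Prop :=
  forall n : nat, inv_poly n (tagged p) = inv_poly n (tagged p').

Definition inv_class (p : permutation) : set permutation :=
  [set p' | inv_Wilf p p']%classic.

(* Main.v *)
Require Import Defs.
From mathcomp Require Import all_boot all_order all_fingroup all_algebra.
From mathcomp Require Import classical_sets.

(** For [p : 'S_k], the polynomials [inv_poly n p] with [n <= k] already
    determine [k] and [inv p]. A pattern is not contained in a shorter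
    permutation, and in a permutation of its own length only if the two are
    equal; hence, writing [T n] for the sum of [q^(inv s)] over all [s : 'S_n],
    one has [inv_poly n p = T n] if [n < k] and
    [inv_poly k p = T k - q^(inv p)]. The first [n] at which [inv_poly n p]
    departs from [T n] is therefore [k], and the defect is [q^(inv p)], so
    inv-Wilf equivalent patterns have the same length and the same inversion
    number ([inv_Wilf_tag], [inv_Wilf_inv]).

    Conversely, the reverse-complement (a half turn of the permutation matrix)
    preserves both inversions and pattern containment, so a pattern is inv-Wilf
    equivalent to its reverse-complement ([inv_Wilf_rev_compl]).

    In ['S_3] the two facts meet: two elements with the same inversion number
    are equal or reverse-complements of each other. So the class of [p : 'S_3]
    is [p] together with its reverse-complement ([inv_class3]), which fixes 123
    and 321 and exchanges 132 with 213 and 231 with 312. *)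

Set Implicit Arguments.
Unset Strict Implicit.
Unset Printing Implicit Defensive.

Import GRing.Theory.
Local Open Scope classical_set_scope.

Local Notation inv := Defs.inv.

(** * One-line notation *)

Lemma size_one_line n (s : 'S_n) : size (one_line s) = n.
Proof. by rewrite size_map -cardE card_ord. Qed.

Lemma nth_one_line n (s : 'S_n) (i : 'I_n) : nth 0 (one_line s) i = (s i).+1.
Proof. by rewrite (nth_map i) ?size_enum_ord // nth_ord_enum. Qed.

Lemma one_line_inj n : injective (@one_line n).
Proof.
move=> s s' eq_line; apply/permP => i; apply: val_inj; apply: succn_inj.
by rewrite -!nth_one_line eq_line.
Qed.

Lemma one_line_tagged_inj (p p' : permutation) :
  one_line (tagged p) = one_line (tagged p') -> p = p'.
Proof.
case: p p' => [n s] [n' s'] /= eq_line.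
have eq_n : n = n' by rewrite -(size_one_line s) eq_line size_one_line.
by case: n' / eq_n in s' eq_line *; rewrite (one_line_inj eq_line).
Qed.

Lemma perm_eq_one_line n (s : 'S_n) : perm_eq (one_line s) (iota 1 n).
Proof.
apply: uniq_perm; rewrite ?iota_uniq //.
  by rewrite map_inj_uniq ?enum_uniq // => i j [/val_inj/perm_inj].
move=> a; rewrite mem_iota add1n ltnS; apply/mapP/andP => [[i _ ->] | []].
  by split=> //; apply: ltn_ord.
case: a => // a _ lt_a.
by exists ((s^-1)%g (Ordinal lt_a)); rewrite ?mem_enum // permKV.
Qed.

Lemma word_one_line n (s : 'S_n) : word (one_line s) = Tagged (fun n => 'S_n) s.
Proof.
apply: one_line_tagged_inj.
by rewrite /= of_wordK // size_one_line perm_eq_one_line.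
Qed.

(** Unlike the cardinality that defines [inv], this form evaluates on explicit
    words. *)
Fixpoint inversions (w : seq nat) : nat :=
  if w is a :: w' then count (ltn^~ a) w' + inversions w' else 0.

Lemma inversionsE (w : seq nat) :
  inversions w = \sum_(i < size w) \sum_(j < size w)
    ((i < j) && (nth 0 w j < nth 0 w i)).
Proof.
elim: w => [|a w IHw]; first by rewrite big_ord0.
rewrite /= IHw big_ord_recl big_ord_recl add0n; congr (_ + _).
  by rewrite -sum1_count big_mkcond (big_nth 0) big_mkord.
by apply: eq_bigr => i _; rewrite big_ord_recl add0n.
Qed.

Lemma inv_one_line n (s : 'S_n) : inv s = inversions (one_line s).
Proof.
rewrite inversionsE size_one_line /inv -sum1_card big_mkcond /= pair_bigA /=.
apply: eq_bigr => -[i j] _ /=.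
by rewrite inE /= !nth_one_line ltnS; case: ifP.
Qed.

(** * Containment in permutations no longer than the pattern *)

Lemma contains_leq k n (s : 'S_n) (p : 'S_k) : contains s p -> k <= n.
Proof.
case/existsP=> f /andP[/forallP f_incr _].
have f_inj : injective f.
  have f_lt (i j : 'I_k) : i < j -> f i < f j := implyP (forallP (f_incr i) j).
  move=> i j eq_f; apply: val_inj.
  by case: (ltngtP i j) => // /f_lt; rewrite eq_f ltnn.
by rewrite -(card_ord k) -(card_ord n) (leq_card f).
Qed.

Lemma ltn_rev_ord n (i j : 'I_n) : (rev_ord i < rev_ord j) = (j < i).
Proof. by rewrite /= ltn_sub2lE. Qed.

(** By induction such a map never goes below the diagonal; its conjugate by the
    order-reversing involution does not either, so it never goes above. *)
Lemma incr_ord_id k (f : 'I_k -> 'I_k) :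
  (forall i j : 'I_k, i < j -> f i < f j) -> f =1 id.
Proof.
have ge_diag (g : 'I_k -> 'I_k) :
    (forall i j : 'I_k, i < j -> g i < g j) -> forall i : 'I_k, i <= g i.
  move=> g_incr [m]; elim: m => [|m IHm] lt_m //=.
  apply: leq_ltn_trans (IHm (ltnW lt_m)) _.
  exact: (g_incr (Ordinal _) (Ordinal _)).
move=> f_incr i; apply: val_inj; apply/eqP; rewrite eqn_leq /=.
rewrite ge_diag ?andbT //.
rewrite leqNgt -ltn_rev_ord -leqNgt -{2}(rev_ordK i).
apply: (ge_diag (fun j => rev_ord (f (rev_ord j)))) => a b lt_ab.
by rewrite ltn_rev_ord f_incr // ltn_rev_ord.
Qed.

(** A permutation is recovered from the relative order of its entries: if [s]
    and [p] are order isomorphic then [a |-> s (p^-1 a)] is increasing, hence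
    the identity. *)
Lemma order_isomorphic_eq k (s p : 'S_k) :
  (forall i j, (s i < s j) = (p i < p j)) -> s = p.
Proof.
move=> iso_sp; apply/permP => i.
suff /(_ (p i)) : (fun a => s ((p^-1)%g a)) =1 id by rewrite permK.
by apply: incr_ord_id => a b lt_ab; rewrite iso_sp !permKV.
Qed.

Lemma contains_same_size k (s p : 'S_k) : contains s p = (s == p).
Proof.
apply/existsP/eqP => [[f /andP[/forallP f_incr /forallP iso_f]] | ->].
  have f_id : f =1 id.
    apply: incr_ord_id => i j; exact: implyP (forallP (f_incr i) j).
  apply: order_isomorphic_eq => i j.
  by have /eqP := forallP (iso_f i) j; rewrite !f_id.
exists [ffun i => i]; apply/andP.
by split; apply/forallP=> i; apply/forallP=> j; rewrite !ffunE //; apply/implyP.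
Qed.

(** * Length and inversion number are inv-Wilf invariants *)

Lemma inv_poly_short n k (p : 'S_k) :
  n < k -> inv_poly n p = (\sum_(s : 'S_n) 'X^(inv s))%R.
Proof.
move=> lt_nk; apply: eq_bigl => s; rewrite inE.
by apply: contraTN lt_nk => /contains_leq; rewrite -leqNgt.
Qed.

Lemma inv_poly_same_size k (p : 'S_k) :
  (\sum_(s : 'S_k) 'X^(inv s) = 'X^(inv p) + inv_poly k p)%R.
Proof.
rewrite (bigD1 p) //=; congr (_ + _)%R.
by apply: eq_bigl => s; rewrite inE contains_same_size.
Qed.

(** If the lengths were different, then at the smaller one the polynomial of the
    shorter pattern would lack a monomial that the other polynomial has. *)
Lemma inv_Wilf_tag (p p' : permutation) : inv_Wilf p p' -> tag p = tag p'.
Proof.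
have no_lt (r r' : permutation) : inv_Wilf r r' -> ~~ (tag r < tag r').
  move=> eq_rr'; apply/negP => lt_rr'; have := eq_rr' (tag r).
  rewrite (inv_poly_short _ lt_rr') (inv_poly_same_size (tagged r)).
  move/eqP; rewrite -subr_eq0 opprD addrCA subrr addr0 oppr_eq0.
  by rewrite (negPf (monic_neq0 (monicXn _ _))).
by move=> eq_pp'; apply/eqP; rewrite eqn_leq !(leqNgt (tag _)) !no_lt.
Qed.

Lemma inv_Wilf_inv k (p p' : 'S_k) :
  inv_Wilf (Tagged (fun n => 'S_n) p) (Tagged (fun n => 'S_n) p') ->
  inv p = inv p'.
Proof.
move=> eq_pp'; have eq_k : inv_poly k p = inv_poly k p' := eq_pp' k.
have := inv_poly_same_size p; rewrite (inv_poly_same_size p') eq_k.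
by move=> /addIr/(congr1 (size \o polyseq)) /=; rewrite !size_polyXn => -[].
Qed.

(** * Reverse-complement *)

Definition rev_compl n (s : 'S_n) : 'S_n :=
  (perm (@rev_ord_inj n) * s * perm (@rev_ord_inj n))%g.

Lemma rev_complE n (s : 'S_n) i : rev_compl s i = rev_ord (s (rev_ord i)).
Proof. by rewrite !permM !permE. Qed.

Lemma rev_complK n : involutive (@rev_compl n).
Proof. by move=> s; apply/permP => i; rewrite !rev_complE !rev_ordK. Qed.

(** The half turn carries the inversion [(i, j)] to the inversion
    [(rev_ord j, rev_ord i)]. *)
Lemma inv_rev_compl n (s : 'S_n) : inv (rev_compl s) = inv s.
Proof.
pose turn (ij : 'I_n * 'I_n) := (rev_ord ij.2, rev_ord ij.1).
have turnK : involutive turn by case=> i j; rewrite /turn /= !rev_ordK.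
rewrite /inv -(card_imset _ (inv_inj turnK)); apply: eq_card => -[i j].
rewrite -[in LHS](turnK (i, j)) (mem_imset _ _ (inv_inj turnK)) !inE.
by rewrite ltn_rev_ord !rev_complE !rev_ordK ltn_rev_ord.
Qed.

Lemma contains_rev_compl k n (s : 'S_n) (p : 'S_k) :
  contains (rev_compl s) (rev_compl p) = contains s p.
Proof.
have half m l (t : 'S_m) (r : 'S_l) :
    contains t r -> contains (rev_compl t) (rev_compl r).
  case/existsP=> f /andP[/forallP f_incr /forallP iso_f]; apply/existsP.
  exists [ffun i => rev_ord (f (rev_ord i))]; apply/andP.
  split; apply/forallP=> i; apply/forallP=> j; rewrite !ffunE.
    rewrite ltn_rev_ord -ltn_rev_ord; exact: forallP (f_incr _) _.
  rewrite !rev_complE !rev_ordK !ltn_rev_ord; exact: forallP (iso_f _) _.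
by apply/idP/idP => [/half|]; rewrite ?rev_complK; last exact: half.
Qed.

Lemma inv_Wilf_rev_compl k (p : 'S_k) :
  inv_Wilf (Tagged (fun n => 'S_n) p) (Tagged (fun n => 'S_n) (rev_compl p)).
Proof.
move=> n; rewrite /inv_poly /= [RHS](reindex_inj (inv_inj (@rev_complK n))) /=.
apply: eq_big => [s | s _]; first by rewrite !inE contains_rev_compl.
by rewrite inv_rev_compl.
Qed.

Lemma one_line_rev_compl n (s : 'S_n) :
  one_line (rev_compl s) = [seq n.+1 - a | a <- rev (one_line s)].
Proof.
apply: (@eq_from_nth _ 0) => [|i]; rewrite size_one_line.
  by rewrite size_map size_rev size_one_line.
move=> lt_i; rewrite (nth_map 0) ?size_rev ?size_one_line //.
rewrite nth_rev ?size_one_line // (nth_one_line _ (Ordinal lt_i)).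
by rewrite (nth_one_line _ (rev_ord (Ordinal lt_i))) rev_complE /= subSn.
Qed.

Lemma rev_compl_word (w : seq nat) :
  perm_eq w (iota 1 (size w)) ->
  Tagged (fun n => 'S_n) (rev_compl (of_word w)) =
    word [seq (size w).+1 - a | a <- rev w].
Proof.
by move=> w_perm; rewrite -word_one_line one_line_rev_compl of_wordK.
Qed.

(** * Patterns of length three *)

Lemma S3_one_line (p : 'S_3) : one_line p \in permutations (iota 1 3).
Proof. by rewrite mem_permutations perm_eq_one_line. Qed.

(** The inversion numbers 0, 1, 1, 2, 2, 3 of the six words leave only the pairs
    132, 213 and 231, 312 to match; it is checked by evaluation. *)
Lemma S3_inv_eq (p q : 'S_3) : inv p = inv q -> q = p \/ q = rev_compl p.
Proof.
have words : all2rel (fun w w' => (inversions w == inversions w') ==>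
    (w' == w) || (w' == [seq 4 - a | a <- rev w])) (permutations (iota 1 3)).
  by vm_compute.
rewrite !inv_one_line => /eqP eq_inv.
have /implyP/(_ eq_inv)/orP :=
  allrelP words _ _ (S3_one_line p) (S3_one_line q).
rewrite -one_line_rev_compl.
by case=> /eqP/one_line_inj; [left | right].
Qed.

Lemma inv_class3 (p : 'S_3) :
  inv_class (Tagged (fun n => 'S_n) p) =
    [set Tagged (fun n => 'S_n) p; Tagged (fun n => 'S_n) (rev_compl p)].
Proof.
apply/seteqP; split=> [[n q] /= eq_pq | _ [|] ->].
- have /= eq_n := inv_Wilf_tag eq_pq; case: n / eq_n in q eq_pq *.
  by case: (S3_inv_eq (inv_Wilf_inv eq_pq)) => ->; [left | right].
- by move=> n.
- exact: inv_Wilf_rev_compl.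
Qed.

Lemma inv_class_word (w : seq nat) :
  perm_eq w (iota 1 3) ->
  inv_class (word w) = [set word w; word [seq 4 - a | a <- rev w]].
Proof.
move=> w_perm; have := perm_size w_perm.
case: w w_perm => [|a [|b [|c []]]] // w_perm _.
by rewrite (inv_class3 (of_word [:: a; b; c])) -(rev_compl_word w_perm).
Qed.

Theorem theorem2p3 :
  [/\ inv_class (word [:: 1; 2; 3]) = [set word [:: 1; 2; 3]],
      inv_class (word [:: 3; 2; 1]) = [set word [:: 3; 2; 1]],
      inv_class (word [:: 1; 3; 2]) =
        [set word [:: 1; 3; 2]; word [:: 2; 1; 3]],
      inv_class (word [:: 2; 3; 1]) =
        [set word [:: 2; 3; 1]; word [:: 3; 1; 2]]
    & [set inv_class (Tagged (fun n => 'S_n) p) | p in [set: 'S_3]] =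
        [set inv_class (word [:: 1; 2; 3]); inv_class (word [:: 3; 2; 1]);
             inv_class (word [:: 1; 3; 2]); inv_class (word [:: 2; 3; 1])]].
Proof.
split.
- by rewrite inv_class_word // setUid.
- by rewrite inv_class_word // setUid.
- by rewrite inv_class_word.
- by rewrite inv_class_word.
apply/seteqP; split=> [_ [p _ <-] | _ /= [[[|]|]|] ->]; last first.
- by exists (of_word [:: 2; 3; 1]).
- by exists (of_word [:: 1; 3; 2]).
- by exists (of_word [:: 3; 2; 1]).
- by exists (of_word [:: 1; 2; 3]).
rewrite -word_one_line /=; have := S3_one_line p.
have -> : permutations (iota 1 3) = [:: [:: 2; 1; 3]; [:: 1; 2; 3];
    [:: 3; 1; 2]; [:: 1; 3; 2]; [:: 2; 3; 1]; [:: 3; 2; 1]].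
  by vm_compute.
rewrite !inE => /or4P[/eqP-> | /eqP-> | /eqP-> | /or3P[] /eqP->].
- by left; right; rewrite !inv_class_word // setUC.
- by left; left; left.
- by right; rewrite !inv_class_word // setUC.
- by left; right.
- by right.
- by left; left; right.
Qed.
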